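(* For the online selection problem with convex cost, with $C\ge 1$ units, valuations in $[L,U]$ ($0<L\le U$), production cost function $f$ and conjugate $h$ with $h(L)>0$, no randomized static pricing algorithm (i.e. for no choice of the distribution of the static price) can achieve a competitive ratio smaller than $1+\ln\frac{h(U)}{h(L)}$.
   Context: Online selection with convex cost: a seller can produce up to $C$ units of an item; producing the first $i$ units costs $f(i)$, where $f:\{0,1,\dots,C\}\to\mathbb{R}_{\ge0}$ is non-decreasing and convex with $f(0)=0$. Buyers $n=1,\dots,N$ arrive one at a time with private valuations $v_n\in[L,U]$; an instance is $I=(v_1,\dots,v_N)$ with arbitrary $N$, unknown to the seller in advance. With $x_n\in\{0,1\}$ indicating whether buyer $n$ buys a unit, the social welfare is $\sum_n v_nx_n-f(\sum_n x_n)$. $\mathrm{OPT}(I)$ is its maximum over $x_n\in\{0,1\}$ with $\sum_n x_n\le C$. For $v\in[L,U]$, $h(v)=\max_{y\in\{0,\dots,C\}}\{vy-f(y)\}$. The effective capacity $\bar C$ is the (largest) maximizer of $Uy-f(y)$ over $y\in\{0,\dots,C\}$. Randomized static pricing algorithm: before any arrival, draw one price $p\in[L,U]$ from a fixed probability distribution; then post $p$ to every buyer, selling one unit to each arriving buyer with $v_n\ge p$ as long as fewer than $\bar C$ units have been sold. $\mathrm{ALG}(I)$ is the resulting social welfare. The algorithm has competitive ratio at most $\alpha$ if $\mathrm{OPT}(I)\le\alpha\,\mathbb{E}[\mathrm{ALG}(I)]$ for every instance $I$, the expectation being over $p$; its competitive ratio is the smallest such $\alpha$ ($+\infty$ if none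 exists). *)

(* Defs.v *)
From HB Require Import structures.
From mathcomp Require Import all_boot all_order all_algebra.
From mathcomp Require Import all_classical all_reals all_analysis.

Set Implicit Arguments.
Unset Strict Implicit.
Unset Printing Implicit Defensive.

Import Order.TTheory GRing.Theory Num.Theory.

Local Open Scope ring_scope.

(* A cost function on {0, ..., C} is represented by f : nat -> R; every
   hypothesis and definition below only depends on its values at 0, ..., C. *)

Definition discrete_nondecreasing (R : realType) (C : nat) (f : nat -> R) :=
  forall i j : nat, (i <= j <= C)%N -> f i <= f j.

(* Jensen's inequality for those convex combinations of points of {0, ..., C}
   that fall in {0, ..., C}. *)
Definition discrete_convex (R : realType) (C : nat) (f : nat -> R) :=
  forall (i j k : nat) (t : R),
    (i <= C)%N -> (j <= C)%N -> (k <= C)%N -> 0 <= t <= 1 ->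
    k%:R = t * i%:R + (1 - t) * j%:R ->
    f k <= t * f i + (1 - t) * f j.

(* The default value of the maximum is the term y = 0. *)
Definition conjugate (R : realType) (C : nat) (f : nat -> R) (v : R) : R :=
  \big[Num.max/(v * 0%:R - f 0%N)]_(y < C.+1) (v * y%:R - f y).

Definition effective_capacity (R : realType) (C : nat) (f : nat -> R) (U : R)
    : nat :=
  \max_(y < C.+1 | U * y%:R - f y == conjugate C f U) y.

(* Buyer n has valuation v`_n and buys a unit iff the n-th bit of x is set. *)
Definition welfare (R : realType) (f : nat -> R) (v : seq R) (x : bitseq) : R :=
  \sum_(n < size v) v`_n * (nth false x n)%:R
  - f (\sum_(n < size v) nth false x n)%N.

(* The default value of the maximum is the welfare of the feasible allocation
   in which nobody buys. *)
Definition OPT (R : realType) (C : nat) (f : nat -> R) (v : seq R) : R :=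
  \big[Num.max/welfare f v (nseq (size v) false)]_(
      x : (size v).-tuple bool | (\sum_(n < size v) nth false x n <= C)%N)
    welfare f v x.

(* Purchase decisions at posted price p under the sales limit B, when [sold]
   units have already been sold. *)
Fixpoint posted_price_sales (R : realType) (B : nat) (p : R) (sold : nat)
    (v : seq R) : bitseq :=
  if v is vn :: v' then
    let xn := (p <= vn) && (sold < B)%N in
    xn :: posted_price_sales B p (sold + xn) v'
  else [::].

Definition ALG (R : realType) (C : nat) (f : nat -> R) (U p : R) (v : seq R)
    : R :=
  welfare f v (posted_price_sales (effective_capacity C f U) p 0 v).

Definition has_competitive_ratio_at_most (R : realType) (C : nat)
    (f : nat -> R) (L U : R) (P : probability (measurableTypeR R) R)
    (alpha : R) : Prop :=
  forall v : seq R, (forall vn, vn \in v -> L <= vn <= U) ->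
    ((OPT C f v)%:E <= alpha%:E * 'E_P[fun p : R => ALG C f U p v])%E.

(* The infimum of the empty set is +oo.  A finite infimum is attained: the
   inequalities defining the set are non-strict in alpha, and the expectations
   are finite since the price only affects ALG through finitely many cases. *)
Definition competitive_ratio (R : realType) (C : nat) (f : nat -> R) (L U : R)
    (P : probability (measurableTypeR R) R) : \bar R :=
  ereal_inf [set alpha%:E | alpha in
    [set alpha : R | has_competitive_ratio_at_most C f L U P alpha]].

(* Main.v *)
(* Put a grid L = v_0 < ... < v_m = U and let I_k consist of C buyers at each of
   v_0, ..., v_k, in increasing order.  A price in the cell ]v_{i-1}, v_i] with
   i <= k sells out to the buyers at v_i, for a welfare of at most h(v_i); a price
   above v_k sells nothing; and OPT(I_k) >= h(v_k).  Hence, if q_i is the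
   probability of the i-th cell, h(v_k) <= alpha * sum_{i <= k} q_i h(v_i) for all
   k.  Abel summation turns this into
     alpha >= alpha * sum_i q_i >= 1 + sum_i (1 - h(v_i) / h(v_{i+1})),
   and since h is C-Lipschitz the right-hand side is within O(1/m) of
   1 + ln (h(U) / h(L)). *)
Require Import Defs.
From HB Require Import structures.
From mathcomp Require Import all_boot all_order all_algebra.
From mathcomp Require Import all_classical all_reals all_analysis.
From mathcomp Require Import ring lra.

Set Implicit Arguments.
Unset Strict Implicit.
Unset Printing Implicit Defensive.

Import Order.TTheory GRing.Theory Num.Theory.

Local Open Scope ring_scope.

(** * Logarithmic lower bound on a sum of weights *)

Lemma ln_le_subV_sqr (R : realType) (x : R) :
  1 <= x -> ln x - (x - 1) ^+ 2 <= 1 - x^-1.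
Proof.
move=> x_ge1; have x_gt0 : 0 < x by lra.
have ln_le : ln x <= x - 1.
  have -> : ln x = ln (1 + (x - 1)) by congr ln; lra.
  by apply: le_ln1Dx; lra.
suff : x - 1 - (1 - x^-1) <= (x - 1) ^+ 2 by lra.
have -> : x - 1 - (1 - x^-1) = (x - 1) ^+ 2 / x by field; lra.
by rewrite ler_pdivrMr // ler_peMr // sqr_ge0.
Qed.

(** Since every [h k] is at least [h 0], [e] bounds all relative increments of [h]. Replacing 1 - h
    k / h k.+1 by ln (h k.+1 / h k) then costs at most [e ^+ 2] per step. *)
Lemma sum_weights_ge (R : realType) (h q : nat -> R) (a e : R) (n : nat) :
  0 < h 0%N ->
  (forall i, (i < n)%N -> h i <= h i.+1 <= h i + e * h 0%N) ->
  (forall k, (k <= n)%N -> h k <= a * \sum_(i < k.+1) q i * h i) ->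
  1 + ln (h n / h 0%N) - n%:R * e ^+ 2 <= a * \sum_(i < n.+1) q i.
Proof.
move=> h0_gt0 h_step hF.
have h_ge k : (k <= n)%N -> h 0%N <= h k.
  elim: k => // k IH lt_kn; apply: le_trans (IH (ltnW lt_kn)) _.
  by case/andP: (h_step k lt_kn).
(* Abel summation, with the mass expressed through the partial sums of [q h]. *)
suff key k : (k <= n)%N ->
    ln (h k / h 0%N) - k%:R * e ^+ 2 + a * (\sum_(i < k.+1) q i * h i) / h k
      <= a * \sum_(i < k.+1) q i.
  apply: le_trans (key n (leqnn n)).
  have hn_gt0 : 0 < h n by apply: lt_le_trans (h_ge n _).
  (* The third term of [key] supplies the constant 1 of the bound. *)
  have : 1 <= a * (\sum_(i < n.+1) q i * h i) / h n.
    by rewrite ler_pdivlMr // mul1r hF.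
  by lra.
elim: k => [_|k IH lt_kn].
  rewrite !big_ord1 divff ?gt_eqF // ln1 mul0r subrr add0r.
  by rewrite -!mulrA divff ?gt_eqF // mulr1.
have le_kn := ltnW lt_kn.
have hk_gt0 : 0 < h k by apply: lt_le_trans (h_ge k _).
have hk1_gt0 : 0 < h k.+1 by apply: lt_le_trans (h_ge k.+1 _).
have /andP[h_le h_lip] := h_step k lt_kn.
rewrite !(big_ord_recr k.+1) /=.
move: (IH le_kn) (hF k le_kn).
set S := \sum_(i < k.+1) q i * h i; set Q := \sum_(i < k.+1) q i => IHk hFk.
set x := h k.+1 / h k.
have x_ge1 : 1 <= x by rewrite ler_pdivlMr // mul1r.
have x_le : x - 1 <= e.
  have e_ge0 : 0 <= e.
    by have : 0 <= e * h 0%N by [lra]; rewrite pmulr_lge0.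
  have -> : x - 1 = (h k.+1 - h k) / h k by rewrite /x; field; rewrite gt_eqF.
  rewrite ler_pdivrMr //; apply: (@le_trans _ _ (e * h 0%N)); first by lra.
  by rewrite ler_wpM2l // h_ge.
have sq_le : (x - 1) ^+ 2 <= e ^+ 2.
  by rewrite ler_sqr ?nnegrE //; lra.
have ln_step : ln (h k.+1 / h 0%N) = ln (h k / h 0%N) + ln x.
  rewrite -lnM ?posrE ?divr_gt0 //; congr ln.
  by rewrite /x; field; rewrite !gt_eqF.
have lnx := ln_le_subV_sqr x_ge1.
(* Enlarging the denominator from [h k] to [h k.+1] lowers the third term of [key]. As
   [a * S >= h k], the drop is large enough to pay for [ln x - e ^+ 2]. *)
have Fk : 1 - x^-1 <= a * S / h k - a * S / h k.+1.
  have -> : a * S / h k - a * S / h k.+1 = (a * S / h k) * (1 - x^-1).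
    by rewrite /x; field; rewrite !gt_eqF.
  apply: ler_peMl; last by rewrite ler_pdivlMr // mul1r.
  by rewrite subr_ge0 invf_le1 //; lra.
have -> : a * (S + q k.+1 * h k.+1) / h k.+1 = a * S / h k.+1 + a * q k.+1.
  by field; rewrite gt_eqF.
rewrite ln_step mulrDr -natr1 mulrDl mul1r.
lra.
Qed.

(** * The conjugate and the effective capacity *)

Section Conjugate.
Variables (R : realType) (C : nat) (f : nat -> R).

Lemma conjugate_ge (v : R) (y : nat) :
  (y <= C)%N -> v * y%:R - f y <= conjugate C f v.
Proof.
move=> le_yC.
exact: (@le_bigmax _ _ _ _ (fun z : 'I_C.+1 => v * z%:R - f z)
                   (Ordinal (le_yC : (y < C.+1)%N))).
Qed.

Lemma conjugate_le (v M : R) :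
  (forall y : nat, (y <= C)%N -> v * y%:R - f y <= M) -> conjugate C f v <= M.
Proof.
by move=> le_M; apply: bigmax_le => [|y _]; apply: le_M; rewrite // -ltnS.
Qed.

Lemma conjugate_mono (v w : R) : v <= w -> conjugate C f v <= conjugate C f w.
Proof.
move=> le_vw; apply: conjugate_le => y le_yC.
apply: le_trans (conjugate_ge _ le_yC).
by rewrite lerD2r ler_wpM2r.
Qed.

(** The conjugate is a maximum of affine functions of slope at most [C]. *)
Lemma conjugate_lipschitz (v w : R) :
  v <= w -> conjugate C f w <= conjugate C f v + C%:R * (w - v).
Proof.
move=> le_vw; apply: conjugate_le => y le_yC.
have := conjugate_ge v le_yC.
have : y%:R * (w - v) <= C%:R * (w - v) by rewrite ler_wpM2r ?subr_ge0 ?ler_nat.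
by lra.
Qed.

Lemma effective_capacity_le (U : R) : (effective_capacity C f U <= C)%N.
Proof. by apply/bigmax_leqP => y _; rewrite -ltnS. Qed.

Lemma effective_capacityP (U : R) :
  U * (effective_capacity C f U)%:R - f (effective_capacity C f U)
    = conjugate C f U.
Proof.
pose F (y : 'I_C.+1) := U * y%:R - f y.
(* The largest maximizer is a maximum of indices with default value 0, so it is known to be a
   maximizer only once some maximizer has been exhibited. *)
have [y0 y0P] : exists y0 : 'I_C.+1, F y0 == conjugate C f U.
  pose y0 := [arg max_(y > ord0 : 'I_C.+1) F y]%O; exists y0.
  rewrite eq_le conjugate_ge /=; last by rewrite -ltnS.
  apply: conjugate_le => y le_yC; rewrite /y0; case: arg_maxP => // i _ maxi.
  exact: (maxi (Ordinal (le_yC : (y < C.+1)%N))).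
have [|y /eqP yP] :=
  @eq_bigmax_cond _ [pred y | F y == conjugate C f U] (fun y => y : nat).
  by apply/card_gt0P; exists y0.
by rewrite /effective_capacity => ->.
Qed.

End Conjugate.

(** * Welfare of concatenated instances *)

Section Welfare.
Variables (R : realType) (f : nat -> R).
Implicit Types (v u : seq R) (x y : bitseq).

(** The cost term keeps welfare from being additive under concatenation, whereas the revenue and the
    number of sales are additive. *)
Definition collected v x : R := \sum_(n < size v) v`_n * (nth false x n)%:R.

Definition sold_units v x : nat := (\sum_(n < size v) nth false x n)%N.

Lemma welfareE v x : welfare f v x = collected v x - f (sold_units v x).
Proof. by []. Qed.

Lemma collected_nil x : collected [::] x = 0.
Proof. exact: big_ord0. Qed.

Lemma collected_cons a v b x :
  collected (a :: v) (b :: x) = a * b%:R + collected v x.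
Proof. exact: big_ord_recl. Qed.

Lemma sold_units_nil x : sold_units [::] x = 0%N.
Proof. exact: big_ord0. Qed.

Lemma sold_units_cons a v b x :
  sold_units (a :: v) (b :: x) = (b + sold_units v x)%N.
Proof. exact: big_ord_recl. Qed.

Lemma collected_cat u v x y : size x = size u ->
  collected (u ++ v) (x ++ y) = collected u x + collected v y.
Proof.
elim: u x => [|a u IH] [|b x] //= => [_|[sz]]; first by rewrite collected_nil add0r.
by rewrite !collected_cons IH // addrA.
Qed.

Lemma sold_units_cat u v x y : size x = size u ->
  sold_units (u ++ v) (x ++ y) = (sold_units u x + sold_units v y)%N.
Proof.
elim: u x => [|a u IH] [|b x] //= => [_|[sz]]; first by rewrite sold_units_nil.
by rewrite !sold_units_cons IH // addnA.
Qed.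

Lemma collected_nseq n w b : collected (nseq n w) (nseq n b) = w * (n * b)%:R.
Proof.
elim: n => [|n IH] /=; first by rewrite collected_nil mulr0.
by rewrite collected_cons IH -mulrDr -natrD.
Qed.

Lemma collected_false v n : collected v (nseq n false) = 0.
Proof. by apply: big1 => i _; rewrite nth_nseq if_same mulr0. Qed.

Lemma sold_units_false v n : sold_units v (nseq n false) = 0%N.
Proof. by apply: big1 => i _; rewrite nth_nseq if_same. Qed.

Lemma sold_units_nseq n (w : R) b : sold_units (nseq n w) (nseq n b) = (n * b)%N.
Proof. by elim: n => [|n IH] //=; rewrite ?sold_units_nil ?sold_units_cons ?IH. Qed.

Lemma OPT_ge C v x : size x = size v -> (sold_units v x <= C)%N ->
  welfare f v x <= OPT C f v.
Proof.
move=> /eqP sz le_C.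
exact: (@le_bigmax_cond _ _ _ _ (Tuple sz) _
                        (fun x : _.-tuple _ => welfare f v x)).
Qed.

(** Turning away all of [v] and serving [y] of the last [C] buyers realizes the term of index [y] in
    the conjugate. *)
Lemma conjugate_le_OPT C v w : conjugate C f w <= OPT C f (v ++ nseq C w).
Proof.
apply: conjugate_le => y le_yC.
pose x := nseq (size v) false ++ nseq y true ++ nseq (C - y) false.
have wE : nseq C w = nseq y w ++ nseq (C - y) w.
  by rewrite -nseqD subnKC.
have soldE : sold_units (v ++ nseq C w) x = y.
  rewrite wE !sold_units_cat ?size_nseq // !sold_units_nseq sold_units_false.
  by rewrite muln1 muln0 addn0.
have -> : w * y%:R - f y = welfare f (v ++ nseq C w) x.
  rewrite welfareE soldE wE !collected_cat ?size_nseq // !collected_nseq.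
  by rewrite collected_false muln1 muln0 mulr0 addr0 add0r.
apply: OPT_ge; last by rewrite soldE.
by rewrite !size_cat !size_nseq subnKC.
Qed.

End Welfare.

(** * Posted-price sales on a block of equal valuations *)

Section PostedPrice.
Variables (R : realType) (B : nat) (p : R).
Implicit Types (v u : seq R).

Lemma posted_price_sales_full v : posted_price_sales B p B v = nseq (size v) false.
Proof. by elim: v => //= a v IH; rewrite ltnn andbF addn0 IH. Qed.

Lemma posted_price_sales_low n w v : w < p ->
  posted_price_sales B p 0 (nseq n w ++ v)
    = nseq n false ++ posted_price_sales B p 0 v.
Proof. by move=> lt_wp; elim: n => //= n IH; rewrite leNgt lt_wp /= IH. Qed.

(** The block is long enough to exhaust the sales limit, so all of [v] is refused. The count [n] of
    earlier sales varies in the induction. *)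
Lemma posted_price_sales_high n k w v : p <= w -> (n <= B <= n + k)%N ->
  posted_price_sales B p n (nseq k w ++ v)
    = nseq (B - n) true ++ nseq (n + k - B + size v) false.
Proof.
move=> le_pw; elim: k n => [|k IH] n.
  rewrite addn0 -eqn_leq => /eqP ->.
  by rewrite subnn posted_price_sales_full.
case/andP; rewrite leq_eqVlt => /predU1P[-> _|lt_nB le_B].
  by rewrite posted_price_sales_full subnn addKn size_cat size_nseq.
rewrite /= le_pw lt_nB /= addn1 IH ?lt_nB ?addSnnS //.
by rewrite -[(B - n)%N]prednK ?subn_gt0 // subnS.
Qed.

End PostedPrice.

(** * Expected welfare on the hard instances *)

Section GridInstance.
Variables (R : realType) (C : nat) (f : nat -> R) (U : R).
Hypothesis f0 : f 0%N = 0.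

Let B := effective_capacity C f U.

Definition block_instance (s : seq R) : seq R := flatten [seq nseq C w | w <- s].

Definition sellout_welfare (w : R) : R := w * B%:R - f B.

Lemma sellout_welfare_le w : sellout_welfare w <= conjugate C f w.
Proof. exact/conjugate_ge/effective_capacity_le. Qed.

(** A block has [C >= B] buyers, so the first block that accepts [p] sells out and ends all
    sales. *)
Lemma ALG_block_instance p s :
  ALG C f U p (block_instance s)
    = oapp sellout_welfare 0 (ohead [seq w <- s | p <= w]).
Proof.
have le_BC : (B <= C)%N := effective_capacity_le C f U.
rewrite /ALG -/B; elim: s => [|w s IH].
  by rewrite welfareE collected_nil sold_units_nil f0 subrr.
have -> : block_instance (w :: s) = nseq C w ++ block_instance s by [].
rewrite [[seq _ <- _ :: _ | _]]/=; case: leP => [le_pw|lt_wp].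
  rewrite posted_price_sales_high //.
  have -> : nseq C w = nseq B w ++ nseq (C - B) w by rewrite -nseqD subnKC.
  rewrite subn0 -catA welfareE collected_cat ?sold_units_cat ?size_nseq //.
  rewrite collected_nseq sold_units_nseq collected_false sold_units_false.
  by rewrite muln1 addr0 addn0.
rewrite posted_price_sales_low // -IH !welfareE.
rewrite collected_cat ?sold_units_cat ?size_nseq //.
by rewrite collected_false sold_units_false add0r.
Qed.

Definition grid_instance (v : nat -> R) (k : nat) : seq R :=
  block_instance [seq v i | i <- iota 0 k.+1].

(* The first cell is unbounded below, so that the cells of v 0, ..., v k and the
   prices above v k exhaust the real line. *)
Definition price_cell (v : nat -> R) (i : nat) : set R :=
  if i is j.+1 then `]v j, v j.+1]%classic else `]-oo, v 0%N]%classic.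

Lemma grid_instanceS v k :
  grid_instance v k.+1 = grid_instance v k ++ nseq C (v k.+1).
Proof.
rewrite /grid_instance /block_instance -addn1 iotaD map_cat map_cat flatten_cat.
by rewrite /= cats0.
Qed.

Lemma ALG_grid_instance v k p : {homo v : i j / (i <= j)%N >-> i <= j} ->
  ALG C f U p (grid_instance v k)
    = \sum_(i < k.+1) sellout_welfare (v i) * \1_(price_cell v i) p.
Proof.
move=> v_mono; rewrite ALG_block_instance; elim: k => [|k IH].
  rewrite big_ord1 /= indicE mem_setE in_itv /=.
  by case: ifP => /=; rewrite (mulr1, mulr0).
have iotaS : iota 0 k.+2 = iota 0 k.+1 ++ [:: k.+1] by rewrite -addn1 iotaD.
rewrite big_ord_recr -IH iotaS map_cat filter_cat.
set low := [seq w <- [seq v i | i <- iota 0 k.+1] | p <= w].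
(* Either an earlier block accepts [p], and [p] is outside the new cell, or no earlier block does
   and only the new one can sell. *)
rewrite /= indicE mem_setE in_itv /=; case: (leP p (v k)) => [le_p|lt_p] /=.
  rewrite mulr0 addr0.
  have : v k \in low by rewrite mem_filter le_p map_f // mem_iota leqnn.
  by case: low.
have -> : low = [::].
  apply/eqP; rewrite -[_ == _]negbK -has_filter.
  apply/hasPn => w /mapP[i]; rewrite mem_iota ltnS => /andP[_ le_ik] ->.
  by rewrite -ltNge; apply: le_lt_trans lt_p; apply: v_mono.
by case: ifP => _ /=; rewrite ?mulr1 ?mulr0 add0r.
Qed.

Lemma price_cell_measurable v i : measurable (price_cell v i).
Proof. by case: i => [|i]; exact: measurable_itv. Qed.

(** The cells are disjoint with union []-oo, v k]]. *)
Lemma sum_price_cell_le (P : probability (measurableTypeR R) R) v k :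
  {homo v : i j / (i <= j)%N >-> i <= j} ->
  \sum_(i < k.+1) fine (P (price_cell v i)) <= 1.
Proof.
move=> v_mono.
suff -> : \sum_(i < k.+1) fine (P (price_cell v i)) = fine (P `]-oo, v k]%classic).
  by rewrite -lee_fin fineK ?fin_num_measure // probability_le1.
elim: k => [|k IH]; first by rewrite big_ord1.
rewrite big_ord_recr IH /= -fineD ?fin_num_measure //.
rewrite -measureU //; last first.
  apply/seteqP; split=> x //= []; rewrite !in_itv /= => le_x /andP[lt_x _].
  by move: lt_x; rewrite ltNge le_x.
congr (fine (P _)); apply/seteqP; split=> x /=; rewrite !in_itv /=.
  by case=> [le_x|/andP[]//]; apply: le_trans le_x (v_mono _ _ (leqnSn k)).
by move=> ->; case: (leP x (v k)); [left|right].
Qed.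

Lemma expectation_ALG_grid (P : probability (measurableTypeR R) R) v k :
  {homo v : i j / (i <= j)%N >-> i <= j} ->
  ('E_P[fun p : R => ALG C f U p (grid_instance v k)]
    = (\sum_(i < k.+1) sellout_welfare (v i) * fine (P (price_cell v i)))%:E)%E.
Proof.
move=> v_mono; rewrite unlock.
under eq_integral => p _ do rewrite ALG_grid_instance // -sumEFin.
have cell_int i : P.-integrable setT (fun p => (\1_(price_cell v i) p)%:E).
  by apply: integrable_indic; exact: price_cell_measurable.
rewrite integral_sum //; last first.
  by move=> i; under eq_fun do rewrite EFinM; apply: integrableZl.
rewrite -sumEFin; apply: eq_bigr => i _.
under eq_integral do rewrite EFinM.
rewrite integralZl // integral_indic //; last exact: price_cell_measurable.
by rewrite setIT EFinM fineK // fin_num_measure //; exact: price_cell_measurable.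
Qed.

Lemma ratio_grid_bound (L alpha : R) (P : probability (measurableTypeR R) R) v k :
  {homo v : i j / (i <= j)%N >-> i <= j} ->
  (forall i, (i <= k)%N -> L <= v i <= U) ->
  has_competitive_ratio_at_most C f L U P alpha ->
  conjugate C f (v k)
    <= alpha * \sum_(i < k.+1) fine (P (price_cell v i)) * sellout_welfare (v i).
Proof.
move=> v_mono v_LU /(_ (grid_instance v k)) ratio.
have : ((conjugate C f (v k))%:E <=
    alpha%:E * 'E_P[fun p : R => ALG C f U p (grid_instance v k)])%E.
  apply: (@le_trans _ _ (OPT C f (grid_instance v k))%:E).
    rewrite lee_fin; case: k {v_LU ratio} => [|k].
      by rewrite /grid_instance /block_instance /= cats0 -[nseq _ _]cat0s conjugate_le_OPT.
    by rewrite grid_instanceS conjugate_le_OPT.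
  apply: ratio => w /flattenP[b /mapP[z /mapP[i]]].
  rewrite mem_iota ltnS => /andP[_ le_ik] -> ->.
  by rewrite mem_nseq => /andP[_ /eqP ->]; apply: v_LU.
rewrite expectation_ALG_grid // -EFinM lee_fin => /le_trans; apply.
by under eq_bigr do rewrite mulrC.
Qed.

(* On C buyers at U every price up to U is optimal: it earns exactly h(U). *)
Lemma ratio_ge0 (L alpha : R) (P : probability (measurableTypeR R) R) :
  L <= U -> 0 < conjugate C f U ->
  has_competitive_ratio_at_most C f L U P alpha -> 0 <= alpha.
Proof.
move=> le_LU hU_gt0 ratio.
have := @ratio_grid_bound L alpha P (fun=> U) 0 _ _ ratio.
rewrite big_ord1 /sellout_welfare effective_capacityP => bound.
have {}bound : conjugate C f U <=
    alpha * (fine (P (price_cell (fun=> U) 0)) * conjugate C f U).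
  by apply: bound => // i _; rewrite le_LU /=.
rewrite leNgt; apply/negP => alpha_lt0.
suff : conjugate C f U <= 0 by rewrite leNgt hU_gt0.
by apply: le_trans bound _; rewrite nmulr_rle0 // mulr_ge0 ?fine_ge0 // ltW.
Qed.

End GridInstance.

(** * The lower bound, by refining the grid *)

Theorem theorem5 (R : realType) (C : nat) (f : nat -> R) (L U : R)
  (C_ge1 : (1 <= C)%N)
  (L_gt0 : 0 < L) (L_le_U : L <= U)
  (f0 : f 0%N = 0)
  (f_ge0 : forall i : nat, (i <= C)%N -> 0 <= f i)
  (f_nondecreasing : discrete_nondecreasing C f)
  (f_convex : discrete_convex C f)
  (hL_gt0 : 0 < conjugate C f L)
  (P : probability (measurableTypeR R) R)
  (P_LU : P [set p : R | L <= p <= U]%classic = 1%E) :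
  ((1 + ln (conjugate C f U / conjugate C f L))%:E
     <= competitive_ratio C f L U P)%E.
Proof.
apply/ereal_infP => _ [alpha ratio <-]; rewrite lee_fin.
(* The sign is needed to multiply by [alpha] the bounds of [sellout_welfare] by the conjugate and of
   the total cell mass by 1. *)
have alpha_ge0 : 0 <= alpha.
  by apply: ratio_ge0 ratio => //; apply: lt_le_trans hL_gt0 (conjugate_mono _ _ L_le_U).
set h := conjugate C f in hL_gt0 *.
(* With [m] equal steps, the Lipschitz bound on an increment of [h] is [(K / m) * h L], so
   [e = K / m] and the total error is [K ^+ 2 / m]; [m] is chosen below to make it at most [eps]. *)
pose K := C%:R * (U - L) / h L.
have K_ge0 : 0 <= K.
  by rewrite divr_ge0 ?(ltW hL_gt0) // mulr_ge0 // subr_ge0.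
apply/ler_addgt0Pr => eps eps_gt0.
pose m := (Num.truncn (K ^+ 2 / eps)).+1.
have m_gt0 : 0 < m%:R :> R by rewrite ltr0n.
have m_large : K ^+ 2 / m%:R <= eps.
  by rewrite ler_pdivrMr // mulrC -ler_pdivrMr // ltW // truncnS_gt.
pose v i := L + i%:R * ((U - L) / m%:R).
have step_ge0 : 0 <= (U - L) / m%:R by rewrite divr_ge0 ?subr_ge0 // ltW.
have v_mono : {homo v : i j / (i <= j)%N >-> i <= j}.
  by move=> i j le_ij; rewrite lerD2l ler_wpM2r // ler_nat.
have v0 : v 0%N = L by rewrite /v mul0r addr0.
have vm : v m = U by rewrite /v; field; rewrite gt_eqF.
have v_LU i : (i <= m)%N -> L <= v i <= U.
  by move=> le_im; rewrite -{1}v0 -vm !v_mono.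
pose q i := fine (P (price_cell v i)).
have q_ge0 i : 0 <= q i by rewrite fine_ge0.
have := @sum_weights_ge R (h \o v) q alpha (K / m%:R) m.
rewrite /= v0 vm => /(_ hL_gt0) bound.
have {bound} : 1 + ln (h U / h L) - m%:R * (K / m%:R) ^+ 2
    <= alpha * \sum_(i < m.+1) q i.
  apply: bound => [i lt_im|k le_km].
    rewrite conjugate_mono ?v_mono //=.
    apply: le_trans (conjugate_lipschitz _ _ (v_mono _ _ (leqnSn i))) _.
    rewrite lerD2l le_eqVlt; apply/orP; left; apply/eqP.
    by rewrite /v /K -natr1; field; rewrite !gt_eqF.
  apply: le_trans (ratio_grid_bound f0 v_mono _ ratio) _.
    by move=> i le_ik; apply: v_LU; apply: leq_trans le_ik le_km.
  rewrite ler_wpM2l // ler_sum // => i _.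
  by apply: ler_wpM2l; [exact: q_ge0|exact: sellout_welfare_le].
have -> : m%:R * (K / m%:R) ^+ 2 = K ^+ 2 / m%:R by field; rewrite gt_eqF.
have : alpha * \sum_(i < m.+1) q i <= alpha.
  by rewrite ler_piMr // sum_price_cell_le.
lra.
Qed.
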